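(* Let $\{d_n\}_1^\infty$ be a sequence of positive numbers, $c>0$, $\nu(x)=\frac{cx}{\sqrt{1+c^2x^2}}$, and let $\beta=\{\beta_n\}_1^\infty\subset\mathbb C^{p\times p}$ be a sequence of selfadjoint matrices satisfying $$\sum_{n=2}^\infty d_n\prod_{k=1}^{n-1}\big(1+c\|\beta_k\|_{\mathbb C^{p\times p}}\big)^2<+\infty .$$ Let $\widehat{\mathbf J}_{X,\beta}$ be the minimal Jacobi operator associated with the block Jacobi matrix whose diagonal entries are $$\widehat{\mathcal A}_{2j}=\mathcal A_{2j}',\qquad\widehat{\mathcal A}_{2j+1}=-\frac{\nu^2(d_{j+1})}{d_{j+1}^3}\big(\beta_{j+1}+d_{j+1}\mathbb I_p+\mathcal A_{2j+1}'\big),$$ and whose off-diagonal entries are $$\widehat{\mathcal B}_{2j}=\frac{\nu(d_{j+1})}{d_{j+1}^2}(\mathbb I_p+\mathcal B_{2j}'),\qquad\widehat{\mathcal B}_{2j+1}=\frac{\nu(d_{j+1})}{d_{j+1}^{3/2}d_{j+2}^{1/2}}(\mathbb I_p+\mathcal B_{2j+1}'),\qquad j\in\mathbb N_0,$$ where $\mathcal A_n'=(\mathcal A_n')^*$, $\mathcal B_n'=(\mathcal B_n')^*\in\mathbb C^{p\times p}$ and $\mathbb I_p+\mathcal B_n'$ is invertible for all $n\in\mathbb N_0$. Assume that for some $N\in\mathbb N_0$: (i) $\displaystyle\sup_{n\ge N}\|\mathcal B_n'\|=a_N<1$; (ii) $\displaystyle\sup_{j\ge1}\frac1{d_{j+1}}\|\mathcal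 B_{2j}'-\mathcal B_{2j-1}'\|<\infty$ and $\displaystyle\sup_{j\ge0}\frac1{(d_{j+1}d_{j+2})^{1/2}}\|\mathcal B_{2j+1}'-\mathcal B_{2j}'\|<\infty$; (iii) $\displaystyle\sup_{j\ge0}\|\mathcal A_{2j}'\|<\infty$ and $\displaystyle\sup_{j\ge0}\frac1{d_{j+1}}\|\mathcal A_{2j+1}'-(\beta_{j+1}+d_{j+1}\mathbb I_p)\mathcal B_{2j}'\|<\infty$. Then the deficiency indices of $\widehat{\mathbf J}_{X,\beta}$ are maximal, i.e. $n_\pm(\widehat{\mathbf J}_{X,\beta})=p$.
   Context: Here $d_n=x_n-x_{n-1}$ for a strictly increasing sequence $X=\{x_n\}_{n\ge0}$ with $x_0=0$. A block Jacobi matrix with entries $\widehat{\mathcal A}_n=\widehat{\mathcal A}_n^*$, $\widehat{\mathcal B}_n$ (invertible) in $\mathbb C^{p\times p}$, $n\in\mathbb N_0$, acts by $(\widehat{\mathbf J}f)_n=\widehat{\mathcal B}_{n-1}^*f_{n-1}+\widehat{\mathcal A}_nf_n+\widehat{\mathcal B}_nf_{n+1}$ (with the term containing $f_{-1}$ omitted for $n=0$); the minimal operator is the closure in $l^2(\mathbb N_0;\mathbb C^p)$ of this map restricted to finitely supported sequences. Deficiency indices: $n_\pm(T)=\dim\ker(T^*\mp iI)$. Matrix norms are operator norms; $\mathbb I_p$ is the identity matrix. *)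

(* Defs.v *)
From mathcomp Require Import all_boot all_order all_algebra.
From mathcomp Require Import complex.
From mathcomp Require Import all_classical all_reals all_analysis.

Set Implicit Arguments.
Unset Strict Implicit.
Unset Printing Implicit Defensive.

Import Order.TTheory GRing.Theory Num.Theory.
Import numFieldNormedType.Exports.

Local Open Scope classical_set_scope.
Local Open Scope ring_scope.
Local Open Scope complex_scope.
Local Open Scope sesquilinear_scope.

Section Matrices.
Variables (R : realType) (p : nat).

(* The real-valued modulus [normc] is used because [`|z|] has type [R[i]]. *)
Definition sqnorm (v : 'cV[R[i]]_p) : R :=
  \sum_i ComplexField.Normc.normc (v i 0) ^+ 2.

(* The supremum is genuine: the set is nonempty (v = 0) and bounded. *)
Definition opnorm (A : 'M[R[i]]_p) : R :=
  sup [set Num.sqrt (sqnorm (A *m v)) | v in [set v | sqnorm v <= 1]].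

End Matrices.

Section SquareSummable.
Variables (R : realType) (p : nat).
Local Notation sequ := (nat -> 'cV[R[i]]_p).

Definition l2 : set sequ :=
  [set f | (\sum_(0 <= n <oo) (sqnorm (f n))%:E < +oo)%E].

Definition l2norm (f : sequ) : R :=
  Num.sqrt (limn (series (fun n => sqnorm (f n)))).

(* Inner product, linear in [f] and conjugate-linear in [g]; the complex
   series is summed through its real and imaginary parts.  Only meaningful for
   [f] and [g] in [l2]. *)
Definition l2dot (f g : sequ) : R[i] :=
  let t n := ((g n) ^t* *m f n) 0 0 in
  limn (series (fun n => complex.Re (t n))) +i*
  limn (series (fun n => complex.Im (t n))).

(* Unbounded operators in l2 are represented by their graphs. *)
Definition l2graph := set (sequ * sequ).

Definition l2closure (T : l2graph) : l2graph :=
  [set fg | [/\ l2 fg.1, l2 fg.2 &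
    forall e : R, 0 < e -> exists fg', [/\ T fg',
      l2norm (fun n => fg'.1 n - fg.1 n) < e &
      l2norm (fun n => fg'.2 n - fg.2 n) < e]]].

(* Since the operators considered are densely defined, this is the graph of
   the adjoint operator. *)
Definition l2adjoint (T : l2graph) : l2graph :=
  [set gh | [/\ l2 gh.1, l2 gh.2 &
    forall f f', T (f, f') -> l2dot f' gh.1 = l2dot f gh.2]].

(* ker (T - z I) *)
Definition l2eigenspace (T : l2graph) (z : R[i]) : set sequ :=
  [set g | T (g, fun n => z *: g n)].

(* [S] is a linear space of dimension [m]. *)
Definition has_dim (S : set sequ) (m : nat) : Prop :=
  exists e : 'I_m -> sequ,
    (forall a : 'I_m -> R[i],
       (forall n, \sum_i a i *: e i n = 0) -> forall i, a i = 0) /\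
    S = [set fun n => \sum_i a i *: e i n | a in [set: 'I_m -> R[i]]].

(* n_+ (T) = m *)
Definition deficiency_index_plus (T : l2graph) (m : nat) : Prop :=
  has_dim (l2eigenspace (l2adjoint T) 'i%C) m.

(* n_- (T) = m *)
Definition deficiency_index_minus (T : l2graph) (m : nat) : Prop :=
  has_dim (l2eigenspace (l2adjoint T) (- 'i%C)) m.

End SquareSummable.

Section BlockJacobi.
Variables (R : realType) (p : nat) (A B : nat -> 'M[R[i]]_p).

Definition jacobi (f : nat -> 'cV[R[i]]_p) (n : nat) : 'cV[R[i]]_p :=
  (if n is m.+1 then (B m) ^t* *m f m else 0) + A n *m f n + B n *m f n.+1.

Definition finitely_supported (f : nat -> 'cV[R[i]]_p) : Prop :=
  exists N, forall n, (N <= n)%N -> f n = 0.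

Definition minimal_jacobi : l2graph R p :=
  l2closure [set (f, jacobi f) | f in finitely_supported].

End BlockJacobi.

Definition nu (R : realType) (c x : R) : R :=
  c * x / Num.sqrt (1 + c ^+ 2 * x ^+ 2).

(* Main.v *)
Require Import Defs.
From mathcomp Require Import all_boot all_order all_algebra.
From mathcomp Require Import complex.
From mathcomp Require Import all_classical all_reals all_analysis.
From mathcomp Require Import ring lra.

(** The adjoint of the minimal operator is the maximal operator: its graph
    consists of the square-summable pairs (g, J g), where J g is computed by the
    three-term recurrence.  This is [l2adjoint_minimal_jacobi]; it follows from
    Green's formula for finitely supported sequences and the continuity of the
    inner product.  Hence ker (J^* - z) is the set of square-summable solutions
    of J f = z f.  As the off-diagonal blocks are invertible, a formal solution
    is determined by its arbitrary first block, so the formal solutions form a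
    space of dimension p, and it suffices that all of them are
    square-summable ([deficiency_maximal]).

    To estimate a formal solution f, put K_n = I + B'_n and rescale:
      f_(2j) = d_(j+1)^(1/2) u_j,
      f_(2j+1) = d_(j+1)^(3/2) / nu(d_(j+1)) v_j.
    The equations J f = z f at the indices 2j+1 and 2j+2 become
      K_(2j+1) u_(j+1) = - K_(2j) u_j
          + (beta_(j+1) + d_(j+1) + A'_(2j+1) + z d_(j+1)^3 / nu^2) v_j,
      K_(2j+2) v_(j+1) = - K_(2j+1) v_j + d_(j+2) (z - A'_(2j+2)) u_(j+1).
    By (iii) the coefficient of v_j is beta_(j+1) K_(2j) + O(d_(j+1)), by (ii)
    consecutive K_n differ by O(d_(j+1) + d_(j+2)), and by (i) their inverses
    are bounded.  So U_j = |K_(2j) u_j| and V_j = |K_(2j) v_j| satisfy, up to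
    relative errors O(d_(j+1) + d_(j+2)),
      U_(j+1) <= U_j + |beta_(j+1)| V_j   and   V_(j+1) <= V_j
    ([transfer_step]).  The quantity c U_j + V_j is therefore multiplied by at
    most exp (O(d_(j+1) + d_(j+2))) (1 + c |beta_(j+1)|) at each step
    ([growth_step]).  Each product in the assumed series is at least 1, so the
    d_n are summable and the exponentials stay bounded: c U_j + V_j is
    O(prod_(k <= j) (1 + c |beta_k|)).  Finally |f_(2j)|^2 + |f_(2j+1)|^2 is
    O(d_(j+1) (U_j^2 + V_j^2)), which is dominated by the terms of the assumed
    series ([formal_solution_l2]). *)

Set Implicit Arguments.
Unset Strict Implicit.
Unset Printing Implicit Defensive.

Import Order.TTheory GRing.Theory Num.Theory.
Import numFieldNormedType.Exports.

Local Open Scope classical_set_scope.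
Local Open Scope ring_scope.
Local Open Scope complex_scope.
Local Open Scope sesquilinear_scope.

Import ComplexField.Normc.

(** * The Euclidean norm and the operator norm *)

Section Euclidean.
Context {R : realType}.

Lemma normc_ge0 (z : R[i]) : 0 <= normc z.
Proof. by case: z => a b; exact: sqrtr_ge0. Qed.

Lemma normc_real (r : R) : normc r%:C = `|r|.
Proof. by rewrite /= expr0n /= addr0 sqrtr_sqr. Qed.

Lemma normc_conj (z : R[i]) : normc (z^*)%R = normc z.
Proof. by case: z => a b /=; rewrite sqrrN. Qed.

Lemma Re_le_normc (z : R[i]) : `|complex.Re z| <= normc z.
Proof.
by case: z => a b /=; rewrite -sqrtr_sqr ler_sqrt ?addr_ge0 ?sqr_ge0// lerDl sqr_ge0.
Qed.

Lemma Im_le_normc (z : R[i]) : `|complex.Im z| <= normc z.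
Proof.
by case: z => a b /=; rewrite -sqrtr_sqr ler_sqrt ?addr_ge0 ?sqr_ge0// lerDr sqr_ge0.
Qed.

Lemma ler_normc_sum (I : Type) (r : seq I) (P : pred I) (F : I -> R[i]) :
  normc (\sum_(i <- r | P i) F i) <= \sum_(i <- r | P i) normc (F i).
Proof.
elim/big_ind2 : _ => [|x1 x2 y1 y2 h1 h2|//]; first by rewrite normc0.
exact: le_trans (le_normcD _ _) (lerD h1 h2).
Qed.

Context {p : nat}.
Implicit Types (u v w : 'cV[R[i]]_p) (A : 'M[R[i]]_p).

Definition vnorm v : R := Num.sqrt (sqnorm v).

Lemma sqnorm_ge0 v : 0 <= sqnorm v.
Proof. by apply: sumr_ge0 => i _; rewrite sqr_ge0. Qed.

Lemma sqnorm0 : sqnorm (0 : 'cV[R[i]]_p) = 0.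
Proof. by rewrite /sqnorm big1// => i _; rewrite mxE normc0 expr0n. Qed.

Lemma sqnormZ (a : R[i]) v : sqnorm (a *: v) = normc a ^+ 2 * sqnorm v.
Proof. by rewrite /sqnorm mulr_sumr; apply: eq_bigr => i _; rewrite mxE normcM exprMn. Qed.

Lemma sqnormZ_real (r : R) v : sqnorm (r%:C *: v) = r ^+ 2 * sqnorm v.
Proof. by rewrite sqnormZ normc_real real_normK ?num_real. Qed.

Lemma sqnormN v : sqnorm (- v) = sqnorm v.
Proof. by apply: eq_bigr => i _; rewrite mxE normcN. Qed.

Lemma vnorm_ge0 v : 0 <= vnorm v.
Proof. exact: sqrtr_ge0. Qed.

Lemma sqr_vnorm v : vnorm v ^+ 2 = sqnorm v.
Proof. by rewrite sqr_sqrtr// sqnorm_ge0. Qed.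

Lemma vnorm0 : vnorm (0 : 'cV[R[i]]_p) = 0.
Proof. by rewrite /vnorm sqnorm0 sqrtr0. Qed.

Lemma vnormZ (a : R[i]) v : vnorm (a *: v) = normc a * vnorm v.
Proof. by rewrite /vnorm sqnormZ sqrtrM ?sqr_ge0// sqrtr_sqr ger0_norm// normc_ge0. Qed.

Lemma vnormN v : vnorm (- v) = vnorm v.
Proof. by rewrite /vnorm sqnormN. Qed.

Lemma normc_le_vnorm v i : normc (v i 0) <= vnorm v.
Proof.
rewrite -(ger0_norm (normc_ge0 _)) -sqrtr_sqr ler_sqrt ?sqnorm_ge0//.
by rewrite /sqnorm (bigD1 i)//= lerDl sumr_ge0// => j _; rewrite sqr_ge0.
Qed.

Lemma vnorm_eq0 v : vnorm v = 0 -> v = 0.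
Proof.
move=> v0; apply/colP => i; rewrite mxE; apply: eq0_normc.
by apply/le_anti; rewrite normc_ge0 andbT -v0 normc_le_vnorm.
Qed.

(** Young's inequality (a + b)^2 <= (1 + s) a^2 + (1 + 1/s) b^2, applied to each
    coordinate.  It is used with s = 1 for the stability of l2 under sums, and
    with the optimal s for the triangle inequality. *)
Lemma sqnormD_le u v (s : R) : 0 < s ->
  sqnorm (u + v) <= (1 + s) * sqnorm u + (1 + s^-1) * sqnorm v.
Proof.
move=> s0; rewrite /sqnorm !mulr_sumr -big_split/=; apply: ler_sum => i _.
rewrite mxE; have := le_normcD (u i 0) (v i 0).
have := normc_ge0 (u i 0 + v i 0).
move: (normc _) (normc (u i 0)) (normc (v i 0)) => n a b n0 nab.
apply: (@le_trans _ _ ((a + b) ^+ 2)); first by rewrite ler_sqr ?nnegrE// (le_trans n0).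
have -> : (1 + s) * a ^+ 2 + (1 + s^-1) * b ^+ 2 =
    (a + b) ^+ 2 + s^-1 * (s * a - b) ^+ 2 by field; exact: lt0r_neq0.
by rewrite lerDl mulr_ge0 ?sqr_ge0 ?invr_ge0 ?ltW.
Qed.

Lemma vnormD u v : vnorm (u + v) <= vnorm u + vnorm v.
Proof.
have [/vnorm_eq0 ->|u0] := eqVneq (vnorm u) 0; first by rewrite vnorm0 !add0r.
have [/vnorm_eq0 ->|v0] := eqVneq (vnorm v) 0; first by rewrite vnorm0 !addr0.
have up : 0 < vnorm u by rewrite lt_neqAle eq_sym u0 vnorm_ge0.
have vp : 0 < vnorm v by rewrite lt_neqAle eq_sym v0 vnorm_ge0.
rewrite -ler_sqr ?nnegrE ?addr_ge0 ?vnorm_ge0// sqr_vnorm.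
(* For this value of s the bound is exactly (|u| + |v|)^2. *)
apply: le_trans (@sqnormD_le u v (vnorm v / vnorm u) _) _; first exact: divr_gt0.
rewrite -!sqr_vnorm le_eqVlt; apply/orP; left; apply/eqP.
by field; rewrite u0.
Qed.

Lemma vnormB u v : vnorm (u - v) <= vnorm u + vnorm v.
Proof. by rewrite (le_trans (vnormD _ _))// vnormN. Qed.

Lemma vnorm_sum (I : Type) (r : seq I) (P : pred I) (F : I -> 'cV[R[i]]_p) :
  vnorm (\sum_(i <- r | P i) F i) <= \sum_(i <- r | P i) vnorm (F i).
Proof.
elim/big_ind2 : _ => [|x1 x2 y1 y2 h1 h2|//]; first by rewrite vnorm0.
exact: le_trans (vnormD _ _) (lerD h1 h2).
Qed.

Local Notation unit_image A :=
  [set Num.sqrt (sqnorm (A *m v)) | v in [set v | sqnorm v <= 1]].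

Lemma has_sup_unit_image A : has_sup (unit_image A).
Proof.
split; first by exists (vnorm (A *m 0)), 0 => //=; rewrite sqnorm0 ler01.
(* A v is a combination of the columns of A with coefficients of modulus at
   most 1. *)
exists (\sum_j vnorm (col j A)) => _ [v /= v1 <-]; rewrite -/(vnorm _).
have -> : A *m v = \sum_j v j 0 *: col j A.
  apply/colP => i; rewrite mxE summxE; apply: eq_bigr => j _.
  by rewrite !mxE mulrC.
apply: le_trans (vnorm_sum _ _ _) _; apply: ler_sum => j _.
rewrite vnormZ ler_piMl ?vnorm_ge0// (le_trans (normc_le_vnorm _ _))//.
by rewrite -(@sqrtr1 R) ler_sqrt.
Qed.

Lemma opnorm_ge0 A : 0 <= opnorm A.
Proof.
apply: (le_trans (vnorm_ge0 (A *m (0 : 'cV[R[i]]_p)))).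
apply: sup_upper_bound; first exact: has_sup_unit_image.
by exists 0 => //=; rewrite sqnorm0 ler01.
Qed.

Lemma vnorm_mulmx A v : vnorm (A *m v) <= opnorm A * vnorm v.
Proof.
have [/vnorm_eq0 ->|v0] := eqVneq (vnorm v) 0; first by rewrite mulmx0 vnorm0 mulr0.
have vp : 0 < vnorm v by rewrite lt_neqAle eq_sym v0 vnorm_ge0.
rewrite -ler_pdivrMr//.
have <- : vnorm (A *m ((vnorm v)^-1%:C *: v)) = vnorm (A *m v) / vnorm v.
  by rewrite -scalemxAr vnormZ normc_real ger0_norm ?invr_ge0 ?vnorm_ge0// mulrC.
apply: sup_upper_bound; first exact: has_sup_unit_image.
exists ((vnorm v)^-1%:C *: v) => //=.
by rewrite sqnormZ_real -sqr_vnorm -exprMn mulVf// expr1n.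
Qed.

Lemma vnorm_mulmx_le A v (M : R) : opnorm A <= M -> vnorm (A *m v) <= M * vnorm v.
Proof. by move=> AM; apply: le_trans (vnorm_mulmx _ _) _; rewrite ler_wpM2r ?vnorm_ge0. Qed.

(** This is the bound 1 / (1 - a) on the inverse of 1 + A: from
    v = (1 + A) v - A v one gets |v| <= |(1 + A) v| + a |v|. *)
Lemma vnorm_le_id_add A v (a : R) : a < 1 -> opnorm A <= a ->
  vnorm v <= (1 - a)^-1 * vnorm ((1%:M + A) *m v).
Proof.
move=> a1 Aa; rewrite mulrC ler_pdivlMr ?subr_gt0// mulrBr mulr1 lerBlDr.
have {1}-> : v = (1%:M + A) *m v - A *m v by rewrite mulmxDl mul1mx addrK.
apply: le_trans (vnormB _ _) _; rewrite lerD2l mulrC.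
exact: vnorm_mulmx_le.
Qed.

Lemma sqnorm_le_id_add A v (a x : R) : a < 1 -> opnorm A <= a ->
  vnorm ((1%:M + A) *m v) <= x -> sqnorm v <= ((1 - a)^-1 * x) ^+ 2.
Proof.
move=> a1 Aa vx; have q0 : 0 <= (1 - a)^-1 by rewrite invr_ge0 subr_ge0 ltW.
have vq := le_trans (vnorm_le_id_add v a1 Aa) (ler_wpM2l q0 vx).
by rewrite -sqr_vnorm ler_sqr ?nnegrE ?vnorm_ge0// (le_trans (vnorm_ge0 v)).
Qed.

(** The Cauchy-Schwarz inequality in the form |x y| <= x^2 / s + s y^2, with free
    s, can be summed over a series directly; a small s then makes the inner
    product small when the first sequence is. *)
Lemma normc_dot_le u v (s : R) : 0 < s ->
  normc ((v ^t* *m u) 0 0) <= sqnorm u / s + s * sqnorm v.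
Proof.
move=> s0; rewrite mxE; apply: le_trans (ler_normc_sum _ _ _) _.
rewrite /sqnorm mulr_suml mulr_sumr -big_split/=; apply: ler_sum => i _.
rewrite !mxE normcM normc_conj.
move: (normc (v i 0)) (normc (u i 0)) (normc_ge0 (v i 0)) (normc_ge0 (u i 0)) => a b a0 b0.
have -> : b ^+ 2 / s + s * a ^+ 2 = a * b + (s^-1 * ((b - s * a) ^+ 2) + a * b).
  by field; exact: lt0r_neq0.
by rewrite lerDl addr_ge0 ?(mulr_ge0 _ (sqr_ge0 _)) ?invr_ge0 ?mulr_ge0 ?(ltW s0).
Qed.

End Euclidean.

(** * Series of real numbers *)

Section Series.
Context {R : realType}.
Implicit Types (x y a b : nat -> R).

(** The estimates below bound partial sums, which are real numbers. *)
Lemma nneseries_bounded (m : nat) x : (forall n, (m <= n)%N -> 0 <= x n) ->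
  (\sum_(m <= n <oo) (x n)%:E < +oo)%E <->
  exists M : R, forall n, \sum_(m <= k < n) x k <= M.
Proof.
move=> x0; have x0' n : (m <= n)%N -> true -> (0 <= (x n)%:E)%E.
  by move=> mn _; rewrite lee_fin x0.
split=> [fin|[M xM]].
  exists (fine (\sum_(m <= n <oo) (x n)%:E)%E) => n.
  rewrite -lee_fin fineK; last first.
    by rewrite ge0_fin_numE// nneseries_ge0.
  by rewrite -sumEFin; exact: nneseries_lim_ge.
apply: (@le_lt_trans _ _ M%:E); last exact: ltry.
apply: lime_le; first exact: is_cvg_nneseries.
by apply: nearW => n; rewrite sumEFin lee_fin.
Qed.

Lemma nneg_series_cvg x (M : R) : (forall n, 0 <= x n) ->
  (forall n, \sum_(0 <= k < n) x k <= M) -> cvgn (series x).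
Proof.
move=> x0 xM; apply: nondecreasing_is_cvgn.
  by apply/nondecreasing_seqP => n; rewrite /series /= big_nat_recr//= lerDl.
by exists M => _ [n _ <-]; exact: xM.
Qed.

(** A series whose terms obey the weighted bound of [normc_dot_le] converges, and
    its sum inherits the bound. *)
Section Dominated.
Variables (a x y : nat -> R).
Hypothesis axy : forall (s : R) n, 0 < s -> `|a n| <= x n / s + s * y n.
Hypotheses (cx : cvgn (series x)) (cy : cvgn (series y)).

Let cxy (s : R) : cvgn (series (s^-1 *: x + s *: y)).
Proof.
by rewrite seriesD; apply: is_cvgD; apply: is_cvg_seriesZ.
Qed.

Let norm_le (s : R) n : 0 < s -> `|a n| <= (s^-1 *: x + s *: y) n.
Proof. by move=> s0; rewrite (le_trans (axy n s0))// mulrC. Qed.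

Let cnorm : cvgn [normed series a].
Proof.
apply: series_le_cvg (@cxy 1) => n //.
- exact: normr_ge0.
- exact: le_trans (normr_ge0 _) (norm_le n ltr01).
- exact: norm_le.
Qed.

Lemma cvg_dominated_series : cvgn (series a).
Proof. exact: normed_cvg cnorm. Qed.

Lemma dominated_series_le (s : R) : 0 < s ->
  `|limn (series a)| <= limn (series x) / s + s * limn (series y).
Proof.
move=> s0; apply: le_trans (lim_series_norm cnorm) _.
have -> : limn (series x) / s + s * limn (series y) = limn (series (s^-1 *: x + s *: y)).
  rewrite lim_seriesD; [|exact: is_cvg_seriesZ|exact: is_cvg_seriesZ].
  by rewrite !lim_seriesZ// mulrC.
by apply: lim_series_le => // n; exact: norm_le.
Qed.

End Dominated.

Lemma lim_series_finite a (M : nat) : (forall n, (M <= n)%N -> a n = 0) ->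
  limn (series a) = \sum_(0 <= k < M) a k.
Proof.
move=> a0; apply: lim_near_cst => //; near=> n.
rewrite /series /= (@big_cat_nat _ _ _ M)//=; last by near: n; exact: nbhs_infty_ge.
suff -> : \sum_(M <= k < n) a k = 0 by rewrite addr0.
by rewrite big_nat big1// => k /andP[Mk _]; exact: a0.
Unshelve. all: by end_near.
Qed.

End Series.

(** * Square-summable sequences *)

Section L2.
Context {R : realType} {p : nat}.
Implicit Types f g h : nat -> 'cV[R[i]]_p.

Lemma l2P f : l2 f <-> exists M : R, forall n, \sum_(0 <= k < n) sqnorm (f k) <= M.
Proof. by apply: nneseries_bounded => n _; exact: sqnorm_ge0. Qed.

Lemma l2_cvg f : l2 f -> cvgn (series (fun n => sqnorm (f n))).
Proof.
move=> /l2P[M fM]; apply: (@nneg_series_cvg _ (fun n => sqnorm (f n)) M) => [n|//].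
exact: sqnorm_ge0.
Qed.

Lemma l2Z (a : R[i]) f : l2 f -> l2 (fun n => a *: f n).
Proof.
move=> /l2P[M fM]; apply/l2P; exists (normc a ^+ 2 * M) => n.
under eq_bigr do rewrite sqnormZ.
by rewrite -mulr_sumr ler_wpM2l ?sqr_ge0.
Qed.

Lemma l2D f g : l2 f -> l2 g -> l2 (fun n => f n + g n).
Proof.
move=> /l2P[M fM] /l2P[M' gM']; apply/l2P; exists (2 * M + 2 * M') => n.
apply: (@le_trans _ _ (\sum_(0 <= k < n) (2 * sqnorm (f k) + 2 * sqnorm (g k)))).
  apply: ler_sum => k _; have := sqnormD_le (f k) (g k) ltr01.
  by rewrite invr1.
by rewrite big_split/= -!mulr_sumr lerD// ler_pM2l.
Qed.

Lemma l2B f g : l2 f -> l2 g -> l2 (fun n => f n - g n).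
Proof.
move=> lf lg; have -> : (fun n => f n - g n) = (fun n => f n + (-1) *: g n).
  by apply/funext => n; rewrite scaleN1r.
exact: l2D (l2Z _ lg).
Qed.

Lemma l2_finite f (M : nat) : (forall n, (M <= n)%N -> f n = 0) -> l2 f.
Proof.
move=> f0; apply/l2P; exists (\sum_(0 <= k < M) sqnorm (f k)) => n.
have [nM|Mn] := leqP n M.
  by rewrite (@big_cat_nat _ _ _ n 0 M)//= lerDl sumr_ge0// => k _; exact: sqnorm_ge0.
rewrite (@big_cat_nat _ _ _ M 0 n)//=; last exact: ltnW.
suff -> : \sum_(M <= k < n) sqnorm (f k) = 0 by rewrite addr0.
by rewrite big_nat big1// => k /andP[Mk _]; rewrite f0// sqnorm0.
Qed.

Lemma l2norm0 : l2norm (fun _ => 0 : 'cV[R[i]]_p) = 0.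
Proof.
rewrite /l2norm (@lim_series_finite _ _ 0); last by move=> n _; exact: sqnorm0.
by rewrite big_geq// sqrtr0.
Qed.

Lemma limn_sqnorm_ge0 f : l2 f -> 0 <= limn (series (fun n => sqnorm (f n))).
Proof.
move=> /l2_cvg cf; apply: limr_ge => //; apply: nearW => n.
by apply: sumr_ge0 => k _; exact: sqnorm_ge0.
Qed.

Lemma limn_sqnorm_lt f (e : R) : l2 f -> 0 < e -> l2norm f < e ->
  limn (series (fun n => sqnorm (f n))) <= e ^+ 2.
Proof.
move=> lf e0 /ltW fe; rewrite -(sqr_sqrtr (limn_sqnorm_ge0 lf)).
by rewrite ler_sqr ?nnegrE ?sqrtr_ge0 ?(ltW e0).
Qed.

Definition dot (v u : 'cV[R[i]]_p) : R[i] := (v ^t* *m u) 0 0.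

Lemma dotBr v u w : dot v (u - w) = dot v u - dot v w.
Proof. by rewrite /dot mulmxBr !mxE. Qed.

(** Since [l2dot] sums real and imaginary parts separately, its continuity is
    proved for an additive map [pr] with |pr z| <= |z|, standing for either
    part. *)
Section Part.
Variable pr : R[i] -> R.
Hypothesis prB : {morph pr : x y / x - y}.
Hypothesis pr_le : forall z, `|pr z| <= normc z.

Let t f g n := pr (dot (g n) (f n)).

Lemma dot_part_le f g (s : R) n : 0 < s ->
  `|t f g n| <= sqnorm (f n) / s + s * sqnorm (g n).
Proof. by move=> s0; exact: le_trans (pr_le _) (normc_dot_le _ _ s0). Qed.

Lemma dot_part_cvg f g : l2 f -> l2 g -> cvgn (series (t f g)).
Proof.
move=> /l2_cvg cf /l2_cvg cg.
by apply: (cvg_dominated_series _ cf cg) => s n; exact: dot_part_le.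
Qed.

Lemma dot_part_B f h g : l2 f -> l2 h -> l2 g ->
  limn (series (t (fun n => f n - h n) g)) = limn (series (t f g)) - limn (series (t h g)).
Proof.
move=> lf lh lg; rewrite -lim_seriesB; [|exact: dot_part_cvg..].
by congr (limn (series _)); apply/funext => n; rewrite /t dotBr prB.
Qed.

Lemma dot_part_small f g (e : R) : l2 f -> l2 g -> 0 < e -> l2norm f < e ->
  `|limn (series (t f g))| <= e * (1 + limn (series (fun n => sqnorm (g n)))).
Proof.
move=> lf lg e0 fe.
apply: le_trans (dominated_series_le _ (l2_cvg lf) (l2_cvg lg) e0) _.
  by move=> s n; exact: dot_part_le.
rewrite mulrDr mulr1 lerD2r ler_pdivrMr// -expr2.
exact: limn_sqnorm_lt.
Qed.

(** The inner product with a fixed element of l2 is continuous, so that an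
    identity <f', g> = <f, h> on a graph extends to the closure of the graph. *)
Lemma dot_part_closure (T : l2graph R p) f f' g h :
  (forall f f', T (f, f') -> [/\ l2 f, l2 f' &
    limn (series (t f' g)) = limn (series (t f h))]) ->
  l2 g -> l2 h -> l2closure T (f, f') ->
  limn (series (t f' g)) = limn (series (t f h)).
Proof.
move=> Tgh lg lh [/= lf lf' cl]; apply/eqP; rewrite -subr_eq0; apply/eqP.
apply/normr0_eq0/le_anti; rewrite normr_ge0 andbT.
set G := limn (series (fun n => sqnorm (g n))).
set H := limn (series (fun n => sqnorm (h n))).
have G0 : 0 <= G by exact: limn_sqnorm_ge0.
have H0 : 0 <= H by exact: limn_sqnorm_ge0.
have GH : 0 < 2 + G + H by lra.
apply/ler_addgt0Pr => e e0; rewrite add0r.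
(* The error is at most (e / (2 + G + H)) ((1 + H) + (1 + G)). *)
have [|[k k'] [/= /Tgh[lk lk' tk] fk fk']] := cl (e / (2 + G + H)).
  exact: divr_gt0.
have -> : limn (series (t f' g)) - limn (series (t f h)) =
  limn (series (t (fun n => k n - f n) h)) - limn (series (t (fun n => k' n - f' n) g)).
  by rewrite !dot_part_B// tk; ring.
apply: le_trans (ler_normB _ _) _.
apply: le_trans (lerD (dot_part_small _ lh _ fk) (dot_part_small _ lg _ fk')) _;
  [exact: l2B|exact: divr_gt0|exact: l2B|exact: divr_gt0|].
rewrite -/G -/H -mulrDr -mulrA ler_piMr ?(ltW e0)// mulrC ler_pdivrMr// mul1r; lra.
Qed.

End Part.

Lemma ReB : {morph @complex.Re R : x y / x - y}. Proof. by case=> [a b] [c d]. Qed.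
Lemma ImB : {morph @complex.Im R : x y / x - y}. Proof. by case=> [a b] [c d]. Qed.

Lemma l2dotE f g : l2dot f g =
  limn (series (fun n => complex.Re (dot (g n) (f n)))) +i*
  limn (series (fun n => complex.Im (dot (g n) (f n)))).
Proof. by []. Qed.

Lemma l2dot_finite f g (M : nat) : (forall n, (M <= n)%N -> f n = 0) ->
  l2dot f g = \sum_(0 <= k < M) dot (g k) (f k).
Proof.
move=> f0; have d0 n : (M <= n)%N -> dot (g n) (f n) = 0.
  by move=> Mn; rewrite /dot f0// mulmx0 mxE.
rewrite l2dotE !(@lim_series_finite _ _ M) => [|n Mn|n Mn]; [|by rewrite d0..].
elim/big_rec3 : _ => // k r i z _ <-.
by case: (dot _ _) => a b /=; rewrite /GRing.add.
Qed.

Lemma l2dot_closure (T : l2graph R p) f f' g h :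
  (forall f f', T (f, f') -> [/\ l2 f, l2 f' & l2dot f' g = l2dot f h]) ->
  l2 g -> l2 h -> l2closure T (f, f') -> l2dot f' g = l2dot f h.
Proof.
move=> Tgh lg lh cl; rewrite !l2dotE; congr (_ +i* _).
- apply: (dot_part_closure ReB (@Re_le_normc _) _ lg lh cl) => k k' /Tgh[lk lk'].
  by rewrite !l2dotE => -[].
- apply: (dot_part_closure ImB (@Im_le_normc _) _ lg lh cl) => k k' /Tgh[lk lk'].
  by rewrite !l2dotE => -[].
Qed.

End L2.

(** * The adjoint of the minimal operator and its eigenspaces *)

Section Jacobi.
Context {R : realType} {p : nat}.
Variables (A B : nat -> 'M[R[i]]_p).
Hypothesis hA : forall n, (A n) ^t* = A n.
Implicit Types f g h : nat -> 'cV[R[i]]_p.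

Lemma adjmxM m n q (X : 'M[R[i]]_(m, n)) (Y : 'M[R[i]]_(n, q)) :
  (X *m Y) ^t* = Y ^t* *m X ^t*.
Proof. by rewrite trmx_mul map_mxM. Qed.

Lemma adjmxD m n (X Y : 'M[R[i]]_(m, n)) : (X + Y) ^t* = X ^t* + Y ^t*.
Proof. by rewrite linearD map_mxD. Qed.

(** Green's formula (summation by parts): as the A_n are self-adjoint, the terms
    cancel in pairs and the boundary term at M remains. *)
Lemma green f g (M : nat) :
  \sum_(0 <= k < M.+1) ((g k) ^t* *m jacobi A B f k - (jacobi A B g k) ^t* *m f k) =
  (g M) ^t* *m B M *m f M.+1 - (g M.+1) ^t* *m (B M) ^t* *m f M.
Proof.
elim: M => [|M IH].
  rewrite big_nat1 /jacobi !add0r !adjmxD !adjmxM hA !mulmxDr !mulmxDl !mulmxA.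
  by rewrite opprD addrACA subrr add0r.
rewrite big_nat_recr//= IH /jacobi !adjmxD !adjmxM hA trmxCK !mulmxDr !mulmxDl !mulmxA.
set a := _ *m f M.+1; set b := _ *m f M; set a' := _ *m f M.+1; set c := _ *m f M.+2.
set d := _ *m f M.+1.
by move: a b a' c d => a b a' c d; apply/matrixP => i j; rewrite !mxE; ring.
Qed.

Lemma jacobi_finite f (M : nat) : (forall n, (M <= n)%N -> f n = 0) ->
  forall n, (M.+1 <= n)%N -> jacobi A B f n = 0.
Proof.
move=> f0 [//|n] Mn.
by rewrite /jacobi (f0 _ Mn) (f0 _ (leqW Mn)) (f0 _ (leqW (leqW Mn))) !mulmx0 !addr0.
Qed.

Lemma jacobi_symmetric f g : finitely_supported f ->
  l2dot (jacobi A B f) g = l2dot f (jacobi A B g).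
Proof.
move=> [M f0]; have f0' n : (M.+1 <= n)%N -> f n = 0 by move=> /ltnW; exact: f0.
rewrite (l2dot_finite _ (jacobi_finite f0)) (l2dot_finite _ f0').
apply/eqP; rewrite -subr_eq0 -sumrB; apply/eqP.
have := congr1 (fun X : 'M[R[i]]_1 => X 0 0) (green f g M).
rewrite /= f0'// f0// !mulmx0 subr0 mxE summxE => sum0.
by rewrite -[RHS]sum0; apply: eq_bigr => k _; rewrite /dot !mxE.
Qed.

Lemma minimal_jacobi_finite f : finitely_supported f ->
  minimal_jacobi A B (f, jacobi A B f).
Proof.
move=> ff; have [M f0] := ff; split => /=.
- exact: l2_finite f0.
- exact: l2_finite (jacobi_finite f0).
move=> e e0; exists (f, jacobi A B f); split => /=; first by exists f.
- by under eq_fun do rewrite subrr; rewrite l2norm0.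
- by under eq_fun do rewrite subrr; rewrite l2norm0.
Qed.

Lemma dot_delta (v : 'cV[R[i]]_p) i : dot v (delta_mx i 0) = (v i 0)^*%R.
Proof. by rewrite /dot -colE !mxE. Qed.

(** Testing the adjoint relation against the sequences with a single nonzero
    coordinate gives h = J g.  Conversely, Green's formula gives the relation for
    finitely supported sequences, and continuity extends it to the closure. *)
Lemma l2adjoint_minimal_jacobi :
  l2adjoint (minimal_jacobi A B) =
  [set gh | [/\ l2 gh.1, l2 gh.2 & gh.2 = jacobi A B gh.1]].
Proof.
apply/seteqP; split => -[g h] /= [lg lh].
- move=> adj; split => //; apply/funext => n; apply/colP => i.
  pose f k : 'cV[R[i]]_p := if k == n then delta_mx i 0 else 0.
  have f0 k : (n.+1 <= k)%N -> f k = 0 by rewrite /f; case: ltngtP.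
  have ff : finitely_supported f by exists n.+1.
  have := adj _ _ (minimal_jacobi_finite ff).
  rewrite (jacobi_symmetric _ ff) !(l2dot_finite _ f0).
  rewrite !big_nat_recr//= {2 4}/f eqxx !dot_delta.
  rewrite ![\sum_(0 <= _ < _) _]big_nat !big1 ?add0r; first last.
  + by move=> k /andP[_ kn]; rewrite /f ltn_eqF// /dot mulmx0 mxE.
  + by move=> k /andP[_ kn]; rewrite /f ltn_eqF// /dot mulmx0 mxE.
  by move=> /(congr1 Num.conj); rewrite !conjCK => ->.
- move=> hE; split => // f f'; apply: l2dot_closure => // k k' [k0 kf [<- <-]].
  have [M k00] := kf; split.
  + exact: l2_finite k00.
  + exact: l2_finite (jacobi_finite k00).
  + by rewrite hE jacobi_symmetric.
Qed.

Hypothesis unitB : forall n, B n \in unitmx.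

(** The recurrence has order two, so a pair of consecutive entries is carried
    along. *)
Fixpoint solution_pair (z : R[i]) (v : 'cV[R[i]]_p) (n : nat) : 'cV[R[i]]_p * 'cV[R[i]]_p :=
  if n is m.+1 then
    let: (f, f') := solution_pair z v m in
    (f', invmx (B m.+1) *m (z *: f' - (B m) ^t* *m f - A m.+1 *m f'))
  else (v, invmx (B 0) *m (z *: v - A 0 *m v)).

Definition solution z v n := (solution_pair z v n).1.

Lemma solutionP z v n : jacobi A B (solution z v) n = z *: solution z v n.
Proof.
have E m : solution z v m.+1 = (solution_pair z v m).2.
  by rewrite /solution /=; case: solution_pair.
case: n => [|n]; rewrite /jacobi !E /=.
  by rewrite mulKVmx//; rewrite /solution /= add0r addrC subrK.
rewrite /solution; case: (solution_pair z v n) => f f' /=.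
by rewrite mulKVmx// -(addrA (z *: f')) -opprD subrKC.
Qed.

Lemma solution_unique z f g : (forall n, jacobi A B f n = z *: f n) ->
  (forall n, jacobi A B g n = z *: g n) -> f 0 = g 0 -> f = g.
Proof.
move=> hf hg fg0.
have BI n : injective (mulmx (B n) : 'cV[R[i]]_p -> 'cV_p).
  by move=> x y /(congr1 (mulmx (invmx (B n)))); rewrite !mulKmx.
suff fg n : f n = g n /\ f n.+1 = g n.+1 by apply/funext => n; case: (fg n).
elim: n => [|n [fgn fgn1]]; split => //.
- apply: (BI 0); move: (hf 0) (hg 0); rewrite /jacobi fg0 => <-.
  by move=> /addrI.
- apply: (BI n.+1); move: (hf n.+1) (hg n.+1); rewrite /jacobi fgn fgn1 => <-.
  by move=> /addrI.
Qed.

Lemma jacobi_lincomb (I : finType) (a : I -> R[i]) (e : I -> nat -> 'cV[R[i]]_p) n :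
  jacobi A B (fun k => \sum_i a i *: e i k) n = \sum_i a i *: jacobi A B (e i) n.
Proof.
rewrite /jacobi; case: n => [|n]; rewrite !mulmx_sumr -?big_split/= ?add0r -?big_split/=.
  by apply: eq_bigr => i _; rewrite !add0r scalerDr !scalemxAr.
by apply: eq_bigr => i _; rewrite !scalerDr !scalemxAr.
Qed.

(** The formal solutions form a p-dimensional space, with the value at 0 as
    coordinate; when they are all square-summable, this space is the
    eigenspace. *)
Lemma deficiency_maximal z :
  (forall f, (forall n, jacobi A B f n = z *: f n) -> l2 f) ->
  has_dim (l2eigenspace (l2adjoint (minimal_jacobi A B)) z) p.
Proof.
move=> hl2; pose e i := solution z (delta_mx i 0).
have sumE a : \sum_i a i *: e i 0 = \col_i a i.
  by rewrite [RHS]matrix_sum_delta; apply: eq_bigr => i _; rewrite big_ord1 mxE.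
exists e; split => [a a0 i|].
  by have := a0 0; rewrite sumE => /colP/(_ i); rewrite !mxE.
rewrite l2adjoint_minimal_jacobi; apply/seteqP; split => [g /= [_ _ gE]|_ [a _ <-]].
  exists (fun i => g 0 i 0) => //; apply: (@solution_unique z).
  - move=> n; rewrite jacobi_lincomb scaler_sumr; apply: eq_bigr => i _.
    by rewrite solutionP !scalerA mulrC.
  - by move=> n; rewrite -gE.
  - by rewrite sumE; apply/colP => i; rewrite mxE.
have sol n : jacobi A B (fun k => \sum_i a i *: e i k) n = z *: \sum_i a i *: e i n.
  rewrite jacobi_lincomb scaler_sumr; apply: eq_bigr => i _.
  by rewrite solutionP !scalerA mulrC.
have lf := hl2 _ sol; split => /=; [exact: lf|exact: l2Z|].
by apply/funext => n; rewrite sol.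
Qed.

End Jacobi.

(** * Growth estimates for the rescaled recurrence *)

Section Recurrence.
Context {R : realType} {p : nat}.

Lemma sqrt_mulr_le_add (x y : R) : 0 <= x -> 0 <= y -> Num.sqrt (x * y) <= x + y.
Proof.
move=> x0 y0; rewrite -(ger0_norm (addr_ge0 x0 y0)) -sqrtr_sqr ler_sqrt ?sqr_ge0//.
rewrite sqrrD; have := mulr_ge0 x0 y0; have := sqr_ge0 x; have := sqr_ge0 y; lra.
Qed.

(** The part of [transfer_step] that only concerns norms: [X] is |(1 + B1) u'|,
    and [nu'], [nv], [nw] are the norms of u', v and w. *)
Lemma transfer_step_arith (b L Z q d d' s nu' nv nw U V X U' V' C e : R) :
  C = 1 + (L + Z) * q -> e = d + d' ->
  0 <= b -> 0 <= L -> 0 <= Z -> 0 <= q -> 0 <= d -> 0 <= d' -> s <= e ->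
  0 <= nu' -> 0 <= nv -> 0 <= U -> 0 <= V -> 0 <= X -> 0 <= U' ->
  nw <= Z * d -> nv <= q * V -> nu' <= q * X -> nu' <= q * U' ->
  X <= nw * nv + U + b * V + d * V + L * d * nv ->
  U' <= X + L * d' * nu' ->
  V' <= V + L * s * nv + d' * (Z * nu' + L * nu') ->
  U' <= (1 + C * e) * (U + (b + C * e) * V) /\
  V' <= (1 + C * e) * V + C * e * U'.
Proof.
move=> defC defe b0 L0 Z0 q0 d0 d'0 se nu'0 nv0 U0 V0 X0 U'0 wZ vV u'X u'U' hX hU' hV'.
have e0 : 0 <= e by rewrite defe addr_ge0.
have LZq0 : 0 <= (L + Z) * q by rewrite mulr_ge0 ?addr_ge0.
have C0 : 0 <= C by rewrite defC addr_ge0.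
have de : d <= e by rewrite defe lerDl.
have d'e : d' <= e by rewrite defe lerDr.
have LqC : L * q <= C.
  by rewrite defC mulrDl; have := mulr_ge0 Z0 q0; lra.
have XU : X <= U + (b + C * e) * V.
  have h1 : nw * nv <= Z * d * (q * V).
    by apply: le_trans (ler_wpM2r nv0 wZ) _; rewrite ler_wpM2l// mulr_ge0.
  have h2 : L * d * nv <= L * d * (q * V) by rewrite ler_wpM2l// mulr_ge0.
  have h3 : C * d * V <= C * e * V by rewrite ler_wpM2r// ler_wpM2l.
  have h4 : Z * d * (q * V) + d * V + L * d * (q * V) = C * d * V by rewrite defC; ring.
  clear -hX h1 h2 h3 h4; lra.
have U'X : U' <= (1 + C * e) * X.
  apply: le_trans hU' _; rewrite (mulrDl 1) mul1r lerD2l.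
  apply: (@le_trans _ _ (L * d' * (q * X))); first by rewrite ler_wpM2l// mulr_ge0.
  have -> : L * d' * (q * X) = (L * q) * d' * X by ring.
  by rewrite ler_wpM2r// ler_pM// mulr_ge0.
split.
  by apply: le_trans U'X _; rewrite ler_wpM2l// addr_ge0// mulr_ge0.
apply: le_trans hV' _.
have h1 : L * s * nv <= C * e * V.
  apply: (@le_trans _ _ (L * e * (q * V))).
    apply: (@le_trans _ _ (L * e * nv)); first by rewrite ler_wpM2r// ler_wpM2l.
    by rewrite ler_wpM2l// mulr_ge0.
  have -> : L * e * (q * V) = (L * q) * (e * V) by ring.
  by rewrite -(mulrA C) ler_wpM2r// mulr_ge0.
have h2 : d' * (Z * nu' + L * nu') <= C * e * U'.
  have -> : d' * (Z * nu' + L * nu') = d' * ((L + Z) * nu') by ring.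
  apply: (@le_trans _ _ (e * ((L + Z) * (q * U')))).
    apply: ler_pM => //; first by rewrite mulr_ge0 ?addr_ge0.
    by rewrite ler_wpM2l// addr_ge0.
  have -> : e * ((L + Z) * (q * U')) = ((L + Z) * q) * (e * U') by ring.
  by rewrite -(mulrA C) ler_wpM2r ?mulr_ge0// defC lerDr.
by rewrite (mulrDl 1) mul1r; apply: lerD => //; rewrite lerD2l.
Qed.

(** One step of the rescaled recurrence.  Here (u, v) and (u', v') are consecutive
    amplitudes, B0, B1, B2 consecutive perturbations of the identity and A1, A2
    the matrices A'_(2j+1), A'_(2j+2).  Up to relative errors of order d + d',
    the step sends U to at most U + |beta| V and V to at most V.  The bound for
    V' is in terms of U', so that the two inequalities can be combined
    linearly. *)
Lemma transfer_step (B0 B1 B2 beta A1 A2 : 'M[R[i]]_p) (u v u' v' : 'cV[R[i]]_p)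
    (z w : R[i]) (d d' a L Z : R) :
  a < 1 -> opnorm B0 <= a -> opnorm B1 <= a -> opnorm B2 <= a ->
  0 < d -> 0 < d' -> 0 <= L -> 0 <= Z -> normc z <= Z -> normc w <= Z * d ->
  opnorm A2 <= L -> opnorm (A1 - (beta + d%:C%:M) *m B0) <= L * d ->
  opnorm (B1 - B0) <= L * Num.sqrt (d * d') -> opnorm (B2 - B1) <= L * d' ->
  (1%:M + B0) *m u - (beta + d%:C%:M + A1) *m v + (1%:M + B1) *m u' = w *: v ->
  (1%:M + B1) *m v + (1%:M + B2) *m v' = d'%:C *: (z *: u' - A2 *m u') ->
  let C := 1 + (L + Z) / (1 - a) in let e := d + d' in
  let U := vnorm ((1%:M + B0) *m u) in let V := vnorm ((1%:M + B0) *m v) in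
  let U' := vnorm ((1%:M + B2) *m u') in let V' := vnorm ((1%:M + B2) *m v') in
  U' <= (1 + C * e) * (U + (opnorm beta + C * e) * V) /\
  V' <= (1 + C * e) * V + C * e * U'.
Proof.
move=> a1 B0a B1a B2a d0 d'0 L0 Z0 zZ wZ A2L A1L B10 B21 equ eqv C e U V U' V'.
have q0 : 0 <= (1 - a)^-1 by rewrite invr_ge0 subr_ge0 ltW.
apply: (transfer_step_arith erefl erefl (opnorm_ge0 beta) L0 Z0 q0 (ltW d0) (ltW d'0)
  (sqrt_mulr_le_add (ltW d0) (ltW d'0)) (vnorm_ge0 u') (vnorm_ge0 v) (vnorm_ge0 _)
  (vnorm_ge0 _) (vnorm_ge0 _) (vnorm_ge0 _) wZ (vnorm_le_id_add v a1 B0a)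
  (vnorm_le_id_add u' a1 B1a) (vnorm_le_id_add u' a1 B2a)).
(* beta + d + A1 = (beta + d) (1 + B0) + (A1 - (beta + d) B0), and the last
   bracket is of order d. *)
- have -> : (1%:M + B1) *m u' = w *: v - (1%:M + B0) *m u + beta *m ((1%:M + B0) *m v)
      + d%:C *: ((1%:M + B0) *m v) + (A1 - (beta + d%:C%:M) *m B0) *m v.
    rewrite -equ !(mulmxDl, mulmxDr, mul1mx, mulmx1, mulmxA, mulNmx) !mul_scalar_mx.
    rewrite -scalemxAl !scalerDr.
    by apply/colP => i; rewrite !mxE; ring.
  apply: le_trans (vnormD _ _) _; apply: lerD; last exact: vnorm_mulmx_le.
  apply: le_trans (vnormD _ _) _; apply: lerD; last by rewrite vnormZ normc_real gtr0_norm.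
  apply: le_trans (vnormD _ _) _; apply: lerD; last exact: vnorm_mulmx.
  by apply: le_trans (vnormB _ _) _; rewrite vnormZ.
- have -> : (1%:M + B2) *m u' = (1%:M + B1) *m u' + (B2 - B1) *m u'.
    by rewrite -mulmxDl -addrA subrKC.
  apply: le_trans (vnormD _ _) _; rewrite lerD2l.
  exact: vnorm_mulmx_le.
- rewrite /V'; have -> : (1%:M + B2) *m v' =
      - ((1%:M + B0) *m v) - (B1 - B0) *m v + d'%:C *: (z *: u' - A2 *m u').
    rewrite -eqv !(mulmxDl, mulNmx) mul1mx.
    by apply/colP => i; rewrite !mxE; ring.
  apply: le_trans (vnormD _ _) _; apply: lerD.
    apply: le_trans (vnormB _ _) _; rewrite vnormN lerD2l.
    exact: vnorm_mulmx_le.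
  rewrite vnormZ normc_real gtr0_norm// ler_wpM2l ?(ltW d'0)//.
  apply: le_trans (vnormB _ _) _; rewrite vnormZ; apply: lerD; last exact: vnorm_mulmx_le.
  by rewrite ler_wpM2r ?vnorm_ge0.
Qed.

(** The weight c on U is what makes beta appear as 1 + c |beta|: without error
    terms, c (U + b V) + V <= (1 + c b) (c U + V).  The error terms contribute
    the factors 1 + C e / c, 1 + C e and 1 + c C e, each bounded by an
    exponential. *)
Lemma growth_step (c C e b U V U' V' : R) : 0 < c -> 0 <= C -> 0 <= e -> 0 <= b ->
  0 <= U -> 0 <= V ->
  U' <= (1 + C * e) * (U + (b + C * e) * V) ->
  V' <= (1 + C * e) * V + C * e * U' ->
  c * U' + V' <= expR ((C / c + C + c * C) * e) * (1 + c * b) * (c * U + V).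
Proof.
move=> c0 C0 e0 b0 U0 V0 hU hV.
have Ce0 : 0 <= C * e by rewrite mulr_ge0.
set x := expR (C / c * e); set y := expR (C * e); set w := expR (c * C * e).
have hx : c + C * e <= c * x.
  have -> : c + C * e = c * (1 + C / c * e) by field; exact: lt0r_neq0.
  by rewrite ler_pM2l// expR_ge1Dx.
have hy : 1 + C * e <= y by exact: expR_ge1Dx.
have hw : 1 + c * C * e <= w by exact: expR_ge1Dx.
have x1 : 1 <= x by rewrite -expR0 ler_expR !mulr_ge0 ?invr_ge0 ?(ltW c0).
have y1 : 1 <= y by rewrite -expR0 ler_expR.
have w1 : 1 <= w by rewrite -expR0 ler_expR !mulr_ge0 ?(ltW c0).
have -> : expR ((C / c + C + c * C) * e) = x * y * w by rewrite -!expRD; congr expR; ring.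
have cb0 : 0 <= c * b by rewrite mulr_ge0// ltW.
have s1 : c * U' + V' <= (c + C * e) * U' + (1 + C * e) * V by lra.
have s2 : (c + C * e) * U' <= c * x * (y * (U + (b + C * e) * V)).
  have [U'0|U'0] := leP 0 U'.
    apply: ler_pM => //; first by rewrite addr_ge0// ltW.
    apply: le_trans hU _; rewrite ler_wpM2r// addr_ge0// mulr_ge0// addr_ge0//.
  apply: (@le_trans _ _ 0).
    by rewrite mulr_ge0_le0 ?(ltW U'0)// addr_ge0 ?(ltW c0).
  by rewrite !mulr_ge0 ?addr_ge0 ?mulr_ge0 ?addr_ge0 ?expR_ge0 ?(ltW c0).
have s3 : (1 + C * e) * V <= x * y * V.
  by rewrite ler_wpM2r// (le_trans hy)// ler_peMl ?expR_ge0.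
have xy0 : 0 <= x * y by rewrite mulr_ge0 ?expR_ge0.
apply: le_trans s1 _; apply: le_trans (lerD s2 s3) _.
have -> : c * x * (y * (U + (b + C * e) * V)) + x * y * V =
  x * y * (c * U + (1 + c * b + c * C * e) * V) by ring.
rewrite -!(mulrA (x * y)); apply: ler_wpM2l => //.
have wb : 1 + c * b + c * C * e <= w * (1 + c * b).
  apply: (@le_trans _ _ ((1 + c * C * e) * (1 + c * b))).
    have : 0 <= (c * C * e) * (c * b) by rewrite mulr_ge0// !mulr_ge0// ltW.
    by lra.
  by rewrite ler_wpM2r// addr_ge0.
have wb1 : 1 <= w * (1 + c * b).
  by apply: mulr_ege1 => //; rewrite lerDl.
rewrite mulrDr lerD//.
- by rewrite ler_peMl// mulr_ge0// ltW.
- exact: ler_wpM2r.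
Qed.

Lemma growth (c D E : R) (b e S : nat -> R) (N : nat) : 0 < c -> 0 <= D ->
  (forall j, 0 <= b j) -> (forall j, 0 <= e j) -> (forall j, 0 <= S j) ->
  (forall n, \sum_(0 <= k < n) e k <= E) ->
  (forall j, (N <= j)%N -> S j.+1 <= expR (D * e j) * (1 + c * b j) * S j) ->
  forall j, (N <= j)%N ->
    S j <= S N * expR (D * E) * \prod_(0 <= k < j) (1 + c * b k).
Proof.
move=> c0 D0 b0 e0 S0 eE step j Nj.
have cb1 k : 1 <= 1 + c * b k by rewrite lerDl mulr_ge0// ltW.
have P1 n : 1 <= \prod_(0 <= k < n) (1 + c * b k).
  by elim/big_ind : _ => // x y; exact: mulr_ege1.
suff H : S j <= S N * expR (D * \sum_(0 <= k < j) e k) * \prod_(0 <= k < j) (1 + c * b k).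
  apply: le_trans H _; rewrite ler_wpM2r ?(le_trans ler01)//.
  by rewrite ler_wpM2l// ler_expR ler_wpM2l.
elim: j Nj => [|j IH]; last rewrite leq_eqVlt => /predU1P[<-|Nj].
- by rewrite leqn0 => /eqP ->; rewrite !big_geq// mulr0 expR0 !mulr1.
- rewrite -mulrA ler_peMr// mulr_ege1//.
  by rewrite -expR0 ler_expR mulr_ge0// sumr_ge0.
- apply: le_trans (step _ Nj) _.
  apply: le_trans (ler_wpM2l _ (IH Nj)) _.
    by rewrite mulr_ge0 ?expR_ge0// (le_trans ler01).
  rewrite !(big_nat_recr j)//= (mulrDr D) expRD.
  rewrite le_eqVlt; apply/orP; left; apply/eqP; ring.
Qed.

End Recurrence.

(** * Auxiliary facts about coefficients and suprema *)

Section Scaling.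
Context {R : realType}.

Lemma nu_gt0 (c x : R) : 0 < c -> 0 < x -> 0 < nu c x.
Proof.
move=> c0 x0; rewrite divr_gt0 ?mulr_gt0// sqrtr_gt0.
by rewrite addr_gt0 ?mulr_gt0 ?exprn_gt0.
Qed.

(** This quantity is both the relative size of the spectral term z f_(2j+1) in the
    rescaled recurrence and the squared factor between f_(2j+1) and its
    amplitude; the right-hand side shows that it is O(x) for bounded x. *)
Lemma cube_div_nu (c x : R) : 0 < c -> 0 < x ->
  x ^+ 3 / nu c x ^+ 2 = x * ((1 + c ^+ 2 * x ^+ 2) / c ^+ 2).
Proof.
move=> c0 x0; rewrite /nu exprMn exprVn sqr_sqrtr; last first.
  by rewrite addr_ge0 ?(mulr_ge0 (sqr_ge0 _) (sqr_ge0 _)).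
have h : 1 + c ^+ 2 * x ^+ 2 != 0.
  by rewrite lt0r_neq0// addr_gt0 ?mulr_gt0 ?exprn_gt0.
by move: (1 + _) h => y h; field; rewrite h !lt0r_neq0.
Qed.

Lemma adjmxZ_real m n (k : R) (X : 'M[R[i]]_(m, n)) : (k%:C *: X) ^t* = k%:C *: X ^t*.
Proof.
by apply/matrixP => i j; rewrite !mxE rmorphM; congr (_ * _); exact: conjc_real.
Qed.

Lemma scale_mulmx m n q (k b r : R) (X : 'M[R[i]]_(m, n)) (Y : 'M[R[i]]_(n, q)) :
  k%:C *: ((b%:C *: X) *m (r%:C *: Y)) = (k * b * r)%:C *: (X *m Y).
Proof. by rewrite -scalemxAl -scalemxAr !scalerA -!rmorphM. Qed.

Lemma parity (n : nat) : exists j, n = (2 * j)%N \/ n = (2 * j).+1.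
Proof.
exists n./2; rewrite mul2n; have := odd_double_half n.
by case: (odd n) => /= <-; [right|left]; rewrite ?add0n ?add1n /= ?doubleK ?uphalf_double.
Qed.

Lemma ereal_sup_bound (I : Type) (S : set I) (F : I -> R) :
  (ereal_sup [set (F j)%:E | j in S] < +oo)%E ->
  exists M : R, 0 <= M /\ forall j, S j -> F j <= M.
Proof.
move=> fin.
have ub j : S j -> ((F j)%:E <= ereal_sup [set (F j)%:E | j in S])%E.
  by move=> Sj; apply: ereal_sup_ubound; exists j.
move: fin ub; case: (ereal_sup _) => [r| |] // _ ub.
  exists (Num.max 0 r); rewrite le_max lexx; split => // j /ub.
  by rewrite lee_fin le_max => ->; rewrite orbT.
by exists 0; split => // j /ub; rewrite leeNy_eq.
Qed.

End Scaling.

(** * Formal solutions of the perturbed recurrence *)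

(** The sequences [d] and [beta] are indexed from 0 here: [d j] and [beta j] stand
    for d_(j+1) and beta_(j+1), the parameters of the blocks 2j and 2j+1. *)
Section Perturbed.
Context {R : realType} {p : nat}.
Variables (c : R) (d : nat -> R) (beta A' B' A B : nat -> 'M[R[i]]_p).
Hypotheses (c0 : 0 < c) (d0 : forall j, 0 < d j).
Hypothesis hbeta : forall j, (beta j) ^t* = beta j.
Hypothesis hA' : forall n, (A' n) ^t* = A' n.
Hypothesis hB' : forall n, (B' n) ^t* = B' n.
Hypothesis hB'unit : forall n, 1%:M + B' n \in unitmx.
Hypothesis hA0 : forall j, A (2 * j)%N = A' (2 * j)%N.
Hypothesis hA1 : forall j, A (2 * j).+1 =
  (- (nu c (d j) ^+ 2 / d j ^+ 3))%:C *: (beta j + (d j)%:C%:M + A' (2 * j).+1).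
Hypothesis hB0 : forall j, B (2 * j)%N =
  (nu c (d j) / d j ^+ 2)%:C *: (1%:M + B' (2 * j)%N).
Hypothesis hB1 : forall j, B (2 * j).+1 =
  (nu c (d j) / (d j * Num.sqrt (d j) * Num.sqrt (d j.+1)))%:C *: (1%:M + B' (2 * j).+1).

Let nu0 j : 0 < nu c (d j). Proof. exact: nu_gt0. Qed.
Let sqrtd0 j : 0 < Num.sqrt (d j). Proof. by rewrite sqrtr_gt0. Qed.

Lemma adj_A n : (A n) ^t* = A n.
Proof.
have [j [->|->]] := parity n; first by rewrite hA0 hA'.
rewrite hA1 adjmxZ_real !adjmxD hbeta hA' tr_scalar_mx map_scalar_mx.
congr (_ *: (_ + _ %:M + _)); exact: conjc_real.
Qed.

Lemma adj_B n : (B n) ^t* = B n.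
Proof.
by have [j [->|->]] := parity n; rewrite ?hB0 ?hB1 adjmxZ_real adjmxD trmx1 map_mx1 hB'.
Qed.

Lemma unit_B n : B n \in unitmx.
Proof.
have unitC (r : R) : 0 < r -> r%:C \is a GRing.unit.
  by move=> r0; rewrite unitfE; apply/eqP => -[] /eqP; rewrite gt_eqF.
have [j [->|->]] := parity n; rewrite ?hB0 ?hB1 unitmxZ// unitC//.
- by rewrite divr_gt0// exprn_gt0.
- by rewrite divr_gt0// !mulr_gt0.
Qed.

Section Solution.
Variables (z : R[i]) (f : nat -> 'cV[R[i]]_p).
Hypothesis hf : forall n, jacobi A B f n = z *: f n.

Let u j := (Num.sqrt (d j))^-1%:C *: f (2 * j)%N.
Let v j := (nu c (d j) / (d j * Num.sqrt (d j)))%:C *: f (2 * j).+1.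

Let fu j : f (2 * j)%N = (Num.sqrt (d j))%:C *: u j.
Proof. by rewrite /u scalerA -rmorphM mulfV ?lt0r_neq0// scale1r. Qed.

Let fv j : f (2 * j).+1 = (d j * Num.sqrt (d j) / nu c (d j))%:C *: v j.
Proof.
rewrite /v scalerA -rmorphM mulrA divfK ?lt0r_neq0// mulfV ?scale1r//.
by rewrite mulf_neq0// lt0r_neq0.
Qed.

(* The equation at the index 2j+1, multiplied by d_(j+1)^(3/2) / nu. *)
Let rec_u j :
  (1%:M + B' (2 * j)%N) *m u j - (beta j + (d j)%:C%:M + A' (2 * j).+1) *m v j
  + (1%:M + B' (2 * j).+1) *m u j.+1 = (z * (d j ^+ 3 / nu c (d j) ^+ 2)%:C) *: v j.
Proof.
have := hf (2 * j).+1; rewrite /jacobi adj_B hA1 hB0 hB1 fu fv.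
have -> : (2 * j).+2 = (2 * j.+1)%N by rewrite mulnS.
rewrite fu; move: (u j) (v j) (u j.+1) => u0 v0 u1.
have dq : d j = Num.sqrt (d j) ^+ 2 by rewrite sqr_sqrtr// ltW.
have /lt0r_neq0 := sqrtd0 j; have /lt0r_neq0 := sqrtd0 j.+1.
have /lt0r_neq0 := nu0 j.
rewrite [in (d j)%:C%:M]/=.
set D := (d j)%:C%:M.
move: (nu c (d j)) (Num.sqrt (d j)) (Num.sqrt (d j.+1)) dq => n q q' -> n0 q'0 q0.
move=> /(congr1 (fun X => (q ^+ 3 / n)%:C *: X)).
rewrite !(scalerDr (q ^+ 3 / n)%:C) !scale_mulmx.
move=> E; transitivity ((q ^+ 3 / n)%:C *: (z *: ((q ^+ 2 * q / n)%:C *: v0))).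
  rewrite -E; congr (_ + _ + _).
  - by rewrite (_ : _ * _ * _ = 1) ?scale1r//; field; rewrite n0 q0.
  - by rewrite (_ : _ * _ * _ = -1) ?rmorphN1 ?scaleN1r//; field; rewrite n0 q0.
  - by rewrite (_ : _ * _ * _ = 1) ?scale1r//; field; rewrite n0 q0 q'0.
rewrite !scalerA; congr (_ *: _).
have -> : q ^+ 2 ^+ 3 / n ^+ 2 = q ^+ 3 / n * (q ^+ 2 * q / n) by field.
by rewrite [in RHS]rmorphM /= mulrCA mulrA.
Qed.

(* The equation at the index 2j+2, multiplied by d_(j+2)^(1/2). *)
Let rec_v j :
  (1%:M + B' (2 * j).+1) *m v j + (1%:M + B' (2 * j).+2) *m v j.+1
  = (d j.+1)%:C *: (z *: u j.+1 - A' (2 * j).+2 *m u j.+1).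
Proof.
have := hf (2 * j).+2; rewrite /jacobi adj_B hB1 fv.
have -> : (2 * j).+2 = (2 * j.+1)%N by rewrite mulnS.
rewrite fu fv hA0 hB0; move: (u j.+1) (v j) (v j.+1) => u1 v0 v1.
have dq i : d i = Num.sqrt (d i) ^+ 2 by rewrite sqr_sqrtr// ltW.
have /lt0r_neq0 := sqrtd0 j; have /lt0r_neq0 := sqrtd0 j.+1.
have /lt0r_neq0 := nu0 j; have /lt0r_neq0 := nu0 j.+1.
move: (nu c (d j)) (nu c (d j.+1)) (Num.sqrt (d j)) (Num.sqrt (d j.+1)) (dq j) (dq j.+1).
move=> n n' q q' -> -> n'0 n0 q'0 q0.
move=> /(congr1 (fun X => q'%:C *: X)).
rewrite !(scalerDr q'%:C) !scale_mulmx -scalemxAr scalerA -rmorphM -expr2.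
have -> : q'%:C *: (z *: (q'%:C *: u1)) = (q' ^+ 2)%:C *: (z *: u1).
  by rewrite !scalerA expr2 rmorphM /= mulrAC.
rewrite (_ : q' * _ * _ = 1); last by field; rewrite n0 q0 q'0.
rewrite (_ : q' * _ * _ = 1); last by field; rewrite n'0 q'0.
rewrite !scale1r => E.
rewrite scalerDr scalerN -E; apply/colP => i; rewrite !mxE; ring.
Qed.

Variables (N : nat) (a L Y : R).
Hypotheses (a1 : a < 1) (L0 : 0 <= L).
Hypothesis hB'a : forall n, (N <= n)%N -> opnorm (B' n) <= a.
Hypothesis hA'L : forall j, opnorm (A' (2 * j)%N) <= L.
Hypothesis hA'B' : forall j,
  opnorm (A' (2 * j).+1 - (beta j + (d j)%:C%:M) *m B' (2 * j)%N) <= L * d j.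
Hypothesis hB'10 : forall j,
  opnorm (B' (2 * j).+1 - B' (2 * j)%N) <= L * Num.sqrt (d j * d j.+1).
Hypothesis hB'21 : forall j,
  opnorm (B' (2 * j).+2 - B' (2 * j).+1) <= L * d j.+1.
Let P j := \prod_(0 <= k < j) (1 + c * opnorm (beta k)).
Hypothesis hY : forall n, \sum_(0 <= k < n) d k * P k ^+ 2 <= Y.

Let P1 j : 1 <= P j.
Proof.
rewrite /P; elim/big_ind : _ => // [x y|k _]; first exact: mulr_ege1.
by rewrite lerDl mulr_ge0 ?opnorm_ge0// ltW.
Qed.

Let dP j : d j <= d j * P j ^+ 2.
Proof. by rewrite ler_peMr ?(ltW (d0 j))// expr_ge1// (le_trans ler01). Qed.

Let sum_d n : \sum_(0 <= k < n) d k <= Y.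
Proof. by apply: le_trans (hY n); apply: ler_sum => k _; exact: dP. Qed.

Let d_le j : d j <= Y.
Proof.
apply: le_trans (sum_d j.+1); rewrite big_nat_recr//= lerDr.
by apply: sumr_ge0 => k _; rewrite ltW.
Qed.

Let K : R := (1 + c ^+ 2 * Y ^+ 2) / c ^+ 2.

Let r_le j : d j ^+ 3 / nu c (d j) ^+ 2 <= K * d j.
Proof.
rewrite cube_div_nu// mulrC ler_wpM2r ?(ltW (d0 j))// ler_wpM2r ?invr_ge0 ?sqr_ge0//.
rewrite lerD2l ler_wpM2l ?sqr_ge0// ler_sqr ?nnegrE ?(ltW (d0 j))//.
by rewrite (le_trans _ (d_le j))// ltW.
Qed.

Let K0 : 0 <= K.
Proof. by rewrite /K divr_ge0 ?sqr_ge0// addr_ge0// (mulr_ge0 (sqr_ge0 _) (sqr_ge0 _)). Qed.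

Let U j := vnorm ((1%:M + B' (2 * j)%N) *m u j).
Let V j := vnorm ((1%:M + B' (2 * j)%N) *m v j).
Let S j := c * U j + V j.

Let U0 j : 0 <= U j. Proof. exact: vnorm_ge0. Qed.
Let V0 j : 0 <= V j. Proof. exact: vnorm_ge0. Qed.
Let S0 j : 0 <= S j. Proof. exact: addr_ge0 (mulr_ge0 (ltW c0) (U0 j)) (V0 j). Qed.

(* [Z] bounds the spectral parameter in both equations: z itself in the second
   and z d^3 / nu^2 <= Z d in the first. *)
Let amplitude_bound : exists2 M, 0 <= M & forall j, (N <= j)%N -> S j <= M * P j.
Proof.
pose Z := normc z * Num.max 1 K.
have Z0 : 0 <= Z by rewrite mulr_ge0 ?normc_ge0// le_max ler01.
have zZ : normc z <= Z by rewrite ler_peMr ?normc_ge0// le_max lexx.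
have wZ j : normc (z * (d j ^+ 3 / nu c (d j) ^+ 2)%:C) <= Z * d j.
  rewrite normcM normc_real ger0_norm; last first.
    by rewrite divr_ge0 ?sqr_ge0// exprn_ge0// ltW.
  rewrite /Z -mulrA ler_wpM2l ?normc_ge0// (le_trans (r_le j))// ler_wpM2r ?(ltW (d0 j))//.
  by rewrite le_max lexx orbT.
pose C := 1 + (L + Z) / (1 - a).
have C0 : 0 <= C by rewrite addr_ge0// divr_ge0 ?(addr_ge0 L0 Z0)// subr_ge0 ltW.
pose e j := d j + d j.+1.
have e0 j : 0 <= e j by rewrite addr_ge0 ?(ltW (d0 _)).
have eE n : \sum_(0 <= k < n) e k <= Y + Y.
  rewrite big_split/= lerD//; apply: le_trans (sum_d n.+1).
  by rewrite big_nat_recl//= lerDr ltW.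
pose D := C / c + C + c * C.
have D0 : 0 <= D.
  exact: addr_ge0 (addr_ge0 (divr_ge0 C0 (ltW c0)) C0) (mulr_ge0 (ltW c0) C0).
exists (S N * expR (D * (Y + Y))); first exact: mulr_ge0 (S0 N) (expR_ge0 _).
apply: (growth (e := e) c0 D0 (fun j => opnorm_ge0 (beta j)) e0 S0 eE) => j Nj.
have N2 : (N <= 2 * j)%N by rewrite mul2n -addnn (leq_trans Nj) ?leq_addr.
have [|stepU stepV] := transfer_step a1 (hB'a N2) (hB'a (leqW N2)) (hB'a (leqW (leqW N2)))
  (d0 j) (d0 j.+1) L0 Z0 zZ (wZ j) _ (hA'B' j) (hB'10 j) (hB'21 j) (rec_u j) (rec_v j).
  by have := hA'L j.+1; rewrite mulnS.
have E : (2 * j).+2 = (2 * j.+1)%N by rewrite mulnS.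
rewrite E in stepU stepV.
exact: (growth_step c0 C0 (e0 j) (opnorm_ge0 _) (U0 j) (V0 j) stepU stepV).
Qed.

(** |f_(2j)|^2 + |f_(2j+1)|^2 is bounded by a multiple of d_(j+1) P_j^2 as soon as
    j >= N, and the partial sums of the latter are bounded by assumption. *)
Lemma formal_solution_l2 : l2 f.
Proof.
have [M M0 SM] := amplitude_bound.
pose q := (1 - a)^-1.
pose g j := sqnorm (f (2 * j)%N) + sqnorm (f (2 * j).+1).
pose M' := (q * (M / c)) ^+ 2 + K * (q * M) ^+ 2.
have M'0 : 0 <= M' by exact: addr_ge0 (sqr_ge0 _) (mulr_ge0 K0 (sqr_ge0 _)).
have gM j : (N <= j)%N -> g j <= M' * (d j * P j ^+ 2).
  move=> Nj; have N2 : (N <= 2 * j)%N by rewrite mul2n -addnn (leq_trans Nj) ?leq_addr.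
  have Sj := SM _ Nj.
  have Uj : U j <= M / c * P j.
    rewrite mulrAC (ler_pdivlMr _ _ c0) mulrC.
    exact: le_trans (ler_wpDr (V0 j) (lexx _)) Sj.
  have Vj : V j <= M * P j.
    exact: le_trans (ler_wpDl (mulr_ge0 (ltW c0) (U0 j)) (lexx _)) Sj.
  have uj : sqnorm (u j) <= (q * (M / c * P j)) ^+ 2.
    exact: sqnorm_le_id_add a1 (hB'a N2) Uj.
  have vj : sqnorm (v j) <= (q * (M * P j)) ^+ 2.
    exact: sqnorm_le_id_add a1 (hB'a N2) Vj.
  have r0 : 0 <= d j ^+ 3 / nu c (d j) ^+ 2.
    exact: divr_ge0 (exprn_ge0 _ (ltW (d0 j))) (sqr_ge0 _).
  have eu : sqnorm (f (2 * j)%N) = d j * sqnorm (u j).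
    by rewrite (fu j) sqnormZ_real (sqr_sqrtr (ltW (d0 j))).
  have ev : sqnorm (f (2 * j).+1) = d j ^+ 3 / nu c (d j) ^+ 2 * sqnorm (v j).
    rewrite (fv j) sqnormZ_real; congr (_ * _).
    by rewrite expr_div_n (exprMn _ (d j)) (sqr_sqrtr (ltW (d0 j))) (exprSr (d j) 2).
  rewrite /g eu ev.
  have h1 := ler_wpM2l (ltW (d0 j)) uj.
  have h2 := ler_pM r0 (sqnorm_ge0 (v j)) (r_le j) vj.
  apply: le_trans (lerD h1 h2) _.
  by rewrite le_eqVlt; apply/orP; left; apply/eqP; rewrite /M'; ring.
have g0 j : 0 <= g j by exact: addr_ge0 (sqnorm_ge0 _) (sqnorm_ge0 _).
have sum_g n : \sum_(0 <= k < n) g k <= \sum_(0 <= k < N) g k + M' * Y.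
  apply: (@le_trans _ _ (\sum_(0 <= k < N) g k + M' * \sum_(0 <= k < n) d k * P k ^+ 2)).
    elim: n => [|n IH].
      by rewrite !(big_geq (leqnn 0)) mulr0 addr0 sumr_ge0.
    have [nN|Nn] := ltnP n N.
      rewrite (@big_cat_nat _ _ _ n.+1 0 N)//= -addrA lerDl addr_ge0 ?sumr_ge0// mulr_ge0//.
      by apply: sumr_ge0 => k _; rewrite (mulr_ge0 (ltW (d0 k)) (sqr_ge0 _)).
    rewrite !(big_nat_recr n)// mulrDr addrA; exact: lerD IH (gM _ Nn).
  by rewrite lerD2l ler_wpM2l.
have pairs n : \sum_(0 <= k < 2 * n) sqnorm (f k) = \sum_(0 <= j < n) g j.
  elim: n => [|n IH]; first by rewrite muln0 !big_geq.
  by rewrite mulnS add2n !big_nat_recr//= IH /g addrA.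
apply/l2P; exists (\sum_(0 <= k < N) g k + M' * Y) => n.
apply: le_trans (sum_g n); rewrite -pairs.
rewrite (@big_cat_nat _ _ _ n 0 (2 * n))//=; last by rewrite mul2n -addnn leq_addr.
by rewrite lerDl sumr_ge0// => k _; exact: sqnorm_ge0.
Qed.

End Solution.
End Perturbed.

(** * Maximality of the deficiency indices *)

Unset Implicit Arguments.

Theorem theorem6p9 (R : realType) (p : nat) (hp : (0 < p)%N)
  (d : nat -> R) (hd : forall n, (1 <= n)%N -> 0 < d n)
  (c : R) (hc : 0 < c)
  (beta : nat -> 'M[R[i]]_p)
  (hbeta : forall n, (1 <= n)%N -> (beta n) ^t* = beta n)
  (hsum : (\sum_(2 <= n <oo)
     (d n * \prod_(1 <= k < n) (1 + c * opnorm (beta k)) ^+ 2)%:E < +oo)%E)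
  (A' B' : nat -> 'M[R[i]]_p)
  (hA' : forall n, (A' n) ^t* = A' n)
  (hB' : forall n, (B' n) ^t* = B' n)
  (hB'unit : forall n, 1%:M + B' n \in unitmx)
  (A B : nat -> 'M[R[i]]_p)
  (hAeven : forall j, A (2 * j)%N = A' (2 * j)%N)
  (hAodd : forall j, A (2 * j + 1)%N =
     (- (nu c (d (j + 1)%N) ^+ 2 / d (j + 1)%N ^+ 3))%:C *:
       (beta (j + 1)%N + (d (j + 1)%N)%:C%:M + A' (2 * j + 1)%N))
  (hBeven : forall j, B (2 * j)%N =
     (nu c (d (j + 1)%N) / d (j + 1)%N ^+ 2)%:C *: (1%:M + B' (2 * j)%N))
  (hBodd : forall j, B (2 * j + 1)%N =
     (nu c (d (j + 1)%N) /
        (d (j + 1)%N `^ (3 / 2) * d (j + 2)%N `^ (1 / 2)))%:C *: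
       (1%:M + B' (2 * j + 1)%N))
  (N : nat) (aN : R)
  (hi : ereal_sup [set (opnorm (B' n))%:E | n in [set n | (N <= n)%N]]
        = aN%:E)
  (haN : aN < 1)
  (hii1 : (ereal_sup [set ((d (j + 1)%N)^-1 *
              opnorm (B' (2 * j)%N - B' (2 * j - 1)%N))%:E
            | j in [set j | (1 <= j)%N]] < +oo)%E)
  (hii2 : (ereal_sup [set (((d (j + 1)%N * d (j + 2)%N) `^ (1 / 2))^-1 *
              opnorm (B' (2 * j + 1)%N - B' (2 * j)%N))%:E
            | j in [set: nat]] < +oo)%E)
  (hiii1 : (ereal_sup [set (opnorm (A' (2 * j)%N))%:E
            | j in [set: nat]] < +oo)%E)
  (hiii2 : (ereal_sup [set ((d (j + 1)%N)^-1 *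
              opnorm (A' (2 * j + 1)%N -
                (beta (j + 1)%N + (d (j + 1)%N)%:C%:M) *m B' (2 * j)%N))%:E
            | j in [set: nat]] < +oo)%E) :
  deficiency_index_plus (minimal_jacobi A B) p /\
  deficiency_index_minus (minimal_jacobi A B) p.
Proof.
have powR_half (x : R) : 0 < x -> x `^ (1 / 2) = Num.sqrt x.
  by move=> x0; rewrite div1r powR12_sqrt// ltW.
have powR_3half (x : R) : 0 < x -> x `^ (3 / 2) = x * Num.sqrt x.
  move=> x0; have -> : 3 / 2 = 1 + 1 / 2 :> R by field.
  rewrite powRD; last by apply/implyP => _; rewrite gt_eqF.
  by rewrite powRr1 ?powR_half// ltW.
pose dl j := d j.+1; pose be j := beta j.+1.
have dl0 j : 0 < dl j by exact: hd.
have [L1 [L1_ge0 hL1]] := ereal_sup_bound hii1.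
have [L2 [L2_ge0 hL2]] := ereal_sup_bound hii2.
have [L3 [L3_ge0 hL3]] := ereal_sup_bound hiii1.
have [L4 [L4_ge0 hL4]] := ereal_sup_bound hiii2.
have hA1 j : A (2 * j).+1 = (- (nu c (dl j) ^+ 2 / dl j ^+ 3))%:C *:
    (be j + (dl j)%:C%:M + A' (2 * j).+1).
  by rewrite -addn1 hAodd addn1.
have hB0 j : B (2 * j)%N = (nu c (dl j) / dl j ^+ 2)%:C *: (1%:M + B' (2 * j)%N).
  by rewrite hBeven addn1.
have hB1 j : B (2 * j).+1 =
    (nu c (dl j) / (dl j * Num.sqrt (dl j) * Num.sqrt (dl j.+1)))%:C *:
    (1%:M + B' (2 * j).+1).
  by rewrite -addn1 hBodd addn1 addn2 powR_3half ?powR_half//; exact: hd.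
have hbe j : (be j) ^t* = be j by exact: hbeta.
have B'a n : (N <= n)%N -> opnorm (B' n) <= aN.
  by move=> Nn; rewrite -lee_fin -hi; apply: ereal_sup_ubound; exists n.
have [Y hY] : exists Y : R, forall n,
    \sum_(0 <= k < n) dl k * (\prod_(0 <= i < k) (1 + c * opnorm (be i))) ^+ 2 <= Y.
  have [|Y0 hY0] := (nneseries_bounded (m := 2)
    (x := fun n => d n * \prod_(1 <= k < n) (1 + c * opnorm (beta k)) ^+ 2) _).1 hsum.
    by move=> n n2; rewrite mulr_ge0 ?prodr_ge0// => [|k _]; rewrite ?sqr_ge0 ?ltW ?hd// ltnW.
  have Y00 : 0 <= Y0 by have := hY0 0; rewrite big_geq.
  (* The assumed series starts at n = 2; the term d_1 is added. *)
  exists (d 1%N + Y0) => -[|n].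
    by rewrite big_geq// addr_ge0// ltW// hd.
  rewrite big_nat_recl//= big_geq// expr1n mulr1 lerD2l.
  have := hY0 n.+2; rewrite !big_add1 /=; congr (_ <= _).
  by apply: eq_bigr => k _; rewrite big_add1 -prodrXl.
pose L := L1 + L2 + L3 + L4.
have L_ge0 : 0 <= L by rewrite !addr_ge0.
suff H z f : (forall n, jacobi A B f n = z *: f n) -> l2 f.
  by split; apply: deficiency_maximal (H _) => n;
    [exact: (adj_A (c := c) (d := dl) (beta := be) (A' := A'))|
     exact: (unit_B hc dl0 hB'unit hB0 hB1)|
     exact: (adj_A (c := c) (d := dl) (beta := be) (A' := A'))|
     exact: (unit_B hc dl0 hB'unit hB0 hB1)].
move=> hf; apply: (formal_solution_l2 hc dl0 hB' hAeven hA1 hB0 hB1 hf haN L_ge0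
  B'a _ _ _ _ hY) => j.
- by rewrite (le_trans (hL3 j I))// /L; lra.
- have := hL4 j I; rewrite !addn1 -/(be j) -/(dl j) mulrC ler_pdivrMr// => /le_trans; apply.
  by rewrite ler_wpM2r ?(ltW (dl0 j))// /L; lra.
- have := hL2 j I; rewrite !addn1 addn2 -/(dl j) -/(dl j.+1) powR_half ?mulr_gt0//.
  rewrite mulrC ler_pdivrMr ?sqrtr_gt0 ?mulr_gt0// => /le_trans; apply.
  by rewrite ler_wpM2r ?sqrtr_ge0// /L; lra.
- have := hL1 j.+1 isT; rewrite addn1 mulnS add2n subn1 /= -/(dl j.+1).
  rewrite mulrC ler_pdivrMr// => /le_trans; apply.
  by rewrite ler_wpM2r ?(ltW (dl0 j.+1))// /L; lra.
Qed.
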